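(* Let $(E,\tau)$ be a locally solid vector lattice, where $\tau$ is locally interval complete solidly submetrisable, and let $F$ be a regular vector sublattice of $E$. Let $(x_\alpha)_{\alpha\in A}$ be a net in $F$ and let $x\in F$ be such that $x_\alpha\to x$ in $\tau$. If $A$ has a largest element $\alpha_{\mathrm{largest}}$, then $x=x_{\alpha_{\mathrm{largest}}}$. If $A$ has no largest element, then one can choose any $\widetilde\alpha_1\in A$, then find an $\alpha_1\in A$, then choose any $\widetilde\alpha_2\in A$, then find an $\alpha_2\in A$, etc., such that: (1) $\alpha_1<\alpha_2<\alpha_3<\dotsb$; (2) $\alpha_n>\widetilde\alpha_n$ for all $n\geq1$; (3) $x_{\alpha_n}$ uo-converges to $x$ in $F$ as $n\to\infty$. In particular, for arbitrary $A$ there exist indices $\alpha_1\leq\alpha_2\leq\alpha_3\leq\dotsb$ such that $x_{\alpha_n}$ uo-converges to $x$ in $F$, and if $A$ has no largest element these indices can be chosen with $\alpha_1<\alpha_2<\alpha_3<\dotsb$.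
   Context: All vector lattices are real and Archimedean; linear topologies are Hausdorff. A locally solid topology on a vector lattice is a linear topology such that zero has a neighbourhood basis of solid sets. A net $(x_\alpha)$ in a vector lattice $G$ order converges to $x$ in $G$ if there is a net $(y_\beta)$ in $G$ with $y_\beta\downarrow0$ such that for each $\beta_0$ there is $\alpha_0$ with $|x_\alpha-x|\leq y_{\beta_0}$ for all $\alpha\geq\alpha_0$; it uo-converges to $x$ in $G$ if $|x_\alpha-x|\wedge|y|$ order converges to $0$ in $G$ for every $y\in G$. A vector sublattice $F$ of $E$ is regular if every net in $F$ that order converges in $F$ to an element of $F$ also order converges in $E$ to it. A locally solid topology $\tau$ on $E$ is locally interval complete solidly submetrisable if for every $x\in E^+$ there exists a metrisable locally solid topology $\widetilde\tau_x$ on the band $B_x$ generated by $x$ such that $\tau|_{B_x}$ is finer than $\widetilde\tau_x$ and every $\widetilde\tau_x$-Cauchy sequence in $[0,x]$ is $\widetilde\tau_x$-convergent to an element of $[0,x]$. *)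

(* Defs.v *)
From HB Require Import structures.
From mathcomp Require Import all_boot all_order all_algebra.
From mathcomp Require Import reals.
Set Implicit Arguments. Unset Strict Implicit. Unset Printing Implicit Defensive.
Import Order.TTheory GRing.Theory Num.Theory.
Local Open Scope ring_scope.

Section VL.
Variables (R : realType) (E : lmodType R).
Variables (le : E -> E -> Prop) (sup : E -> E -> E).

Definition is_vector_lattice : Prop :=
  (forall x, le x x) /\
  (forall x y, le x y -> le y x -> x = y) /\
  (forall x y z, le x y -> le y z -> le x z) /\
  (forall x y z, le x y -> le (x + z) (y + z)) /\
  (forall (a : R) x y, 0 <= a -> le x y -> le (a *: x) (a *: y)) /\
  (forall x y, [/\ le x (sup x y), le y (sup x y) &
                  forall z, le x z -> le y z -> le (sup x y) z]) /\
  (forall x y, le 0 x -> (forall n : nat, le (x *+ n) y) -> x = 0).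

Definition vinf (x y : E) : E := - sup (- x) (- y).
Definition vabs (x : E) : E := sup x (- x).

Definition interval (a b : E) : E -> Prop := fun y => le a y /\ le y b.

Definition subspace (G : E -> Prop) : Prop :=
  [/\ G 0, (forall x y, G x -> G y -> G (x + y)) &
      (forall (a : R) x, G x -> G (a *: x))].

Definition sublattice (G : E -> Prop) : Prop :=
  subspace G /\ (forall x y, G x -> G y -> G (sup x y)).

Definition directed (A : Type) (leA : A -> A -> Prop) : Prop :=
  [/\ (exists a : A, True),
      (forall a, leA a a),
      (forall a b c, leA a b -> leA b c -> leA a c) &
      (forall a b, exists c, leA a c /\ leA b c)].

Definition strict (A : Type) (leA : A -> A -> Prop) (a b : A) : Prop :=
  leA a b /\ ~ leA b a.

Definition order_conv (G : E -> Prop) (A : Type) (leA : A -> A -> Prop)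
    (xa : A -> E) (x : E) : Prop :=
  exists (B : Type) (leB : B -> B -> Prop) (y : B -> E),
    directed leB /\
    (forall b, G (y b)) /\
    (forall b b', leB b b' -> le (y b') (y b)) /\
    (forall b, le 0 (y b)) /\
    (forall z, G z -> (forall b, le z (y b)) -> le z 0) /\
    (forall b0, exists a0, forall a, leA a0 a -> le (vabs (xa a - x)) (y b0)).

Definition uo_conv (G : E -> Prop) (A : Type) (leA : A -> A -> Prop)
    (xa : A -> E) (x : E) : Prop :=
  forall y, G y ->
    order_conv G leA (fun a => vinf (vabs (xa a - x)) (vabs y)) 0.

Definition regular (F : E -> Prop) : Prop :=
  forall (A : Type) (leA : A -> A -> Prop) (xa : A -> E) (x : E),
    directed leA -> (forall a, F (xa a)) -> F x ->
    order_conv F leA xa x -> order_conv (fun _ => True) leA xa x.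

Definition solid_in (G S : E -> Prop) : Prop :=
  (forall x, S x -> G x) /\
  (forall x y, S x -> G y -> le (vabs y) (vabs x) -> S y).

Definition ideal (I : E -> Prop) : Prop := subspace I /\ solid_in (fun _ => True) I.

Definition is_sup_of (D : E -> Prop) (z : E) : Prop :=
  (forall d, D d -> le d z) /\ (forall w, (forall d, D d -> le d w) -> le z w).

Definition band (B : E -> Prop) : Prop :=
  ideal B /\ (forall D z, (forall d, D d -> B d) -> is_sup_of D z -> B z).

Definition band_gen (x : E) : E -> Prop :=
  fun y => forall B, band B -> B x -> B y.

Definition topology_on (G : E -> Prop) (T : (E -> Prop) -> Prop) : Prop :=
  [/\ (forall U, T U -> forall x, U x -> G x),
      T G, T (fun _ => False),
      (forall (I : Type) (U : I -> E -> Prop), (forall i, T (U i)) ->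
          T (fun x => exists i, U i x)) &
      (forall U V, T U -> T V -> T (fun x => U x /\ V x))].

Definition hausdorff_on (G : E -> Prop) (T : (E -> Prop) -> Prop) : Prop :=
  forall x y, G x -> G y -> x <> y ->
    exists U V, [/\ T U, T V, U x, V y & forall z, U z -> V z -> False].

Definition linear_on (G : E -> Prop) (T : (E -> Prop) -> Prop) : Prop :=
  (forall U x y, T U -> G x -> G y -> U (x + y) ->
     exists V W, [/\ T V, T W, V x, W y & forall v w, V v -> W w -> U (v + w)]) /\
  (forall U (a : R) x, T U -> G x -> U (a *: x) ->
     exists (d : R) V, [/\ 0 < d, T V, V x &
        forall (b : R) v, `|b - a| < d -> V v -> U (b *: v)]).

Definition locally_solid_on (G : E -> Prop) (T : (E -> Prop) -> Prop) : Prop :=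
  [/\ topology_on G T, hausdorff_on G T, linear_on G T &
      forall U, T U -> U 0 ->
        exists N, [/\ solid_in G N,
                      (exists V, [/\ T V, V 0 & forall z, V z -> N z]) &
                      forall z, N z -> U z]].

Definition metrisable_on (G : E -> Prop) (T : (E -> Prop) -> Prop) : Prop :=
  exists d : E -> E -> R,
    [/\ (forall x y, G x -> G y -> 0 <= d x y),
        (forall x y, G x -> G y -> (d x y = 0 <-> x = y)),
        (forall x y, G x -> G y -> d x y = d y x),
        (forall x y z, G x -> G y -> G z -> d x z <= d x y + d y z) &
        (forall U, (forall x, U x -> G x) ->
           (T U <-> forall x, U x -> exists2 e : R, 0 < e &
                       forall y, G y -> d x y < e -> U y))].

Definition net_conv (T : (E -> Prop) -> Prop) (A : Type) (leA : A -> A -> Prop)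
    (xa : A -> E) (x : E) : Prop :=
  forall U, T U -> U x -> exists a0, forall a, leA a0 a -> U (xa a).

Definition seq_conv (T : (E -> Prop) -> Prop) (u : nat -> E) (z : E) : Prop :=
  net_conv T (fun m n : nat => (m <= n)%N) u z.

Definition cauchy_seq (T : (E -> Prop) -> Prop) (u : nat -> E) : Prop :=
  forall V, T V -> V 0 -> exists n0, forall m n, (n0 <= m)%N -> (n0 <= n)%N ->
    V (u m - u n).

Definition restr_finer (tau : (E -> Prop) -> Prop) (G : E -> Prop)
    (T : (E -> Prop) -> Prop) : Prop :=
  forall U, T U -> exists V, tau V /\ (forall z, U z <-> (V z /\ G z)).

Definition lics_submetrisable (tau : (E -> Prop) -> Prop) : Prop :=
  forall x, le 0 x ->
    exists T : (E -> Prop) -> Prop,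
      [/\ locally_solid_on (band_gen x) T,
          metrisable_on (band_gen x) T,
          restr_finer tau (band_gen x) T &
          forall u : nat -> E, (forall n, interval 0 x (u n)) -> cauchy_seq T u ->
            exists2 z, interval 0 x z & seq_conv T u z].

End VL.

(* Main.v *)
(* Put [u_n = |x_(alpha_n) - x|].  The sequence is chosen so that for every [k]
   the terms [u_n /\ u_k], [n > k], are summably small in a metrisable topology
   on the band of [u_k], chosen as soon as [alpha_k] is known.  Completeness of
   [0, u_k] then provides the suprema of the tails of [u_n /\ u_k], and these
   decrease to 0 in E.

   For [y] in [F], let [0 <= z] be a lower bound in [F] of all elements of [F]
   that eventually dominate [u_n /\ |y|].  By regularity [z] is also below all
   elements of [E] with this property.  Smallness of [u_n /\ u_k] gives
   [z /\ u_k = 0] for all [k]; so if [w] dominates the [u_n /\ |y|], then so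
   does [w - z], and [z = 0] by the Archimedean property.  Hence the eventual
   upper bounds in [F] decrease to 0 in [F], which is uo-convergence in [F]. *)
Require Import Defs.
From HB Require Import structures.
From mathcomp Require Import all_boot all_order all_algebra.
From mathcomp Require Import boolp reals.
From Stdlib Require List.
Import Order.TTheory GRing.Theory Num.Theory.
Set Implicit Arguments. Unset Strict Implicit. Unset Printing Implicit Defensive.
Local Open Scope ring_scope.

(** * Order theory *)

Section VectorLattice.
Variables (R : realType) (E : lmodType R).
Variables (le : E -> E -> Prop) (sup : E -> E -> E).
Hypothesis VL : is_vector_lattice le sup.

Local Notation inf := (vinf sup).
Local Notation abs := (vabs sup).

Lemma le_refl x : le x x.
Proof. by case: VL => h _. Qed.

Lemma le_anti x y : le x y -> le y x -> x = y.
Proof. by case: VL => _ [h _]; apply: h. Qed.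

Lemma le_trans y x z : le x y -> le y z -> le x z.
Proof. by case: VL => _ [_ [h _]]; apply: h. Qed.

Lemma le_add2r z x y : le x y -> le (x + z) (y + z).
Proof. by case: VL => _ [_ [_ [h _]]]; apply: h. Qed.

Lemma le_scale (a : R) x y : 0 <= a -> le x y -> le (a *: x) (a *: y).
Proof. by case: VL => _ [_ [_ [_ [h _]]]]; apply: h. Qed.

Lemma le_supl x y : le x (sup x y).
Proof. by case: VL => _ [_ [_ [_ [_ [h _]]]]]; case: (h x y). Qed.

Lemma le_supr x y : le y (sup x y).
Proof. by case: VL => _ [_ [_ [_ [_ [h _]]]]]; case: (h x y). Qed.

Lemma sup_le x y z : le x z -> le y z -> le (sup x y) z.
Proof. by case: VL => _ [_ [_ [_ [_ [h _]]]]]; case: (h x y) => _ _; apply. Qed.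

Lemma archimedean x y : le 0 x -> (forall n : nat, le (x *+ n) y) -> x = 0.
Proof. by case: VL => _ [_ [_ [_ [_ [_ h]]]]]; apply: h. Qed.

Lemma le_add x y z t : le x y -> le z t -> le (x + z) (y + t).
Proof.
move=> xy zt; apply: (le_trans (le_add2r z xy)).
by rewrite ![y + _]addrC; apply: le_add2r.
Qed.

Lemma le_subl_addr x y z : le (x - y) z <-> le x (z + y).
Proof.
by split=> [/(le_add2r y)|/(le_add2r (- y))]; rewrite ?subrK ?addrK.
Qed.

Lemma le_subr_addr x y z : le x (z - y) <-> le (x + y) z.
Proof.
by split=> [/(le_add2r y)|/(le_add2r (- y))]; rewrite ?subrK ?addrK.
Qed.

Lemma le_sub0 x y : le 0 (y - x) <-> le x y.
Proof. by rewrite le_subr_addr add0r. Qed.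

Lemma le_opp x y : le x y -> le (- y) (- x).
Proof. by move=> xy; apply/le_sub0; rewrite opprK addrC; apply/le_sub0. Qed.

Lemma inf_lel x y : le (inf x y) x.
Proof. by rewrite -[X in le _ X]opprK; apply/le_opp/le_supl. Qed.

Lemma inf_ler x y : le (inf x y) y.
Proof. by rewrite -[X in le _ X]opprK; apply/le_opp/le_supr. Qed.

Lemma le_inf x y z : le z x -> le z y -> le z (inf x y).
Proof.
by move=> zx zy; rewrite -[z]opprK; apply/le_opp/sup_le; apply: le_opp.
Qed.

(** One half of the identity for meet plus join: [x + y - sup x y] lies below both [x] and [y]. *)
Lemma add_inf_sup x y : le (x + y) (inf x y + sup x y).
Proof.
rewrite addrC -le_subl_addr; apply: le_inf; apply/le_subl_addr.
  by rewrite addrC; apply: le_add; [exact: le_refl|exact: le_supr].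
by apply: le_add; [exact: le_refl|exact: le_supl].
Qed.

Lemma le_abs x : le x (abs x).
Proof. exact: le_supl. Qed.

Lemma le_absN x : le (- x) (abs x).
Proof. exact: le_supr. Qed.

Lemma abs_le x y : le x y -> le (- x) y -> le (abs x) y.
Proof. exact: sup_le. Qed.

Lemma abs_ge0 x : le 0 (abs x).
Proof.
have h : le 0 (abs x + abs x).
  by rewrite -(subrr x); apply: le_add; [exact: le_abs|exact: le_absN].
have h2 : (0 : R) <= 2^-1 by rewrite invr_ge0.
have := le_scale h2 h.
by rewrite scaler0 -mulr2n -scaler_nat scalerA mulVf ?pnatr_eq0// scale1r.
Qed.

Lemma ge0_abs x : le 0 x -> abs x = x.
Proof.
move=> x0; apply: le_anti (le_abs x); apply: abs_le; first exact: le_refl.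
by apply: le_trans (x0); rewrite -oppr0; apply: le_opp.
Qed.

Lemma absN x : abs (- x) = abs x.
Proof.
have h y : le (abs (- y)) (abs y).
  by apply: abs_le; [exact: le_absN|rewrite opprK; exact: le_abs].
by apply: le_anti; rewrite // -{1}[x]opprK.
Qed.

Lemma abs_distC x y : abs (x - y) = abs (y - x).
Proof. by rewrite -absN opprB. Qed.

Lemma abs0 : abs 0 = 0.
Proof. by rewrite ge0_abs//; exact: le_refl. Qed.

Lemma inf_ge0 x y : le 0 x -> le 0 y -> le 0 (inf x y).
Proof. exact: le_inf. Qed.

(* If [p] can be subtracted over and over from [b] without leaving the upper
   bounds of a single element, then [p] vanishes by the Archimedean property. *)
Lemma shift_eq0 (Q : E -> Prop) v b p :
  le 0 p -> Q b -> (forall d, Q d -> le v d) -> (forall d, Q d -> Q (d - p)) ->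
  p = 0.
Proof.
move=> p0 Qb Qv Qp; apply: (archimedean (y := b - v)) => // n.
have Qn : Q (b - p *+ n).
  by elim: n => [|n IH]; rewrite ?mulr0n ?subr0// mulrSr opprD addrA; apply: Qp.
by apply/le_subr_addr; rewrite addrC; apply/le_subr_addr; exact: Qv.
Qed.

(** * Regular sublattices: from bounds in [F] to bounds in [E] *)

Lemma sublattice_opp F x : sublattice sup F -> F x -> F (- x).
Proof. by move=> [[_ _ h] _] Fx; rewrite -scaleN1r; apply: h. Qed.

Lemma sublattice_sub F x y : sublattice sup F -> F x -> F y -> F (x - y).
Proof.
by move=> sF Fx Fy; case: (sF) => [[_ h _] _]; apply: h => //; exact: sublattice_opp.
Qed.

Lemma sublattice_inf F x y : sublattice sup F -> F x -> F y -> F (inf x y).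
Proof.
by move=> sF Fx Fy; apply: sublattice_opp => //; apply: (sF.2); exact: sublattice_opp.
Qed.

Lemma sublattice_abs F x : sublattice sup F -> F x -> F (abs x).
Proof. by move=> sF Fx; apply: (sF.2) => //; exact: sublattice_opp. Qed.

(* The differences (upper bound in F) - (element of F below all upper bounds
   in E) decrease to 0 in F, hence in E by regularity. *)
Lemma regular_upper_bound F (P : E -> Prop) v b z w :
  sublattice sup F -> regular le sup F -> (forall u, P u -> F u) -> P v ->
  F b -> (forall u, P u -> le u b) ->
  (forall d, F d -> (forall u, P u -> le u d) -> le z d) ->
  (forall u, P u -> le u w) -> le z w.
Proof.
move=> sF rF PF Pv Fb bP zP wP.
pose UB d := F d /\ forall u, P u -> le u d.
pose LB s := F s /\ forall d, (forall u, P u -> le u d) -> le s d.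
pose I := ({d | UB d} * {s | LB s})%type.
pose leI (i j : I) := le (sval j.1) (sval i.1) /\ le (sval i.2) (sval j.2).
pose y (i : I) := sval i.1 - sval i.2.
have iP (i : I) : UB (sval i.1) /\ LB (sval i.2) by split; apply: svalP.
have LBP u : P u -> LB u by move=> Pu; split=> [|d]; [exact: PF|exact].
have y0 i : le 0 (y i).
  by case: (iP i) => [[_ h] [_ h']]; apply/le_sub0/h'.
have Fy i : F (y i).
  by case: (iP i) => [[h _] [h' _]]; apply: sublattice_sub.
have dI : directed leI.
  split; first by exists (exist _ b (conj Fb bP), exist _ v (LBP v Pv)).
  - by move=> i; split; exact: le_refl.
  - by move=> i j k [h1 h2] [h3 h4]; split; [exact: le_trans h3 h1|exact: le_trans h2 h4].
  move=> i j; case: (iP i) => [[Fi Ui] [Fi' Li]]; case: (iP j) => [[Fj Uj] [Fj' Lj]].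
  have Um : UB (inf (sval i.1) (sval j.1)).
    split; first exact: sublattice_inf.
    by move=> u Pu; apply: le_inf; [exact: Ui|exact: Uj].
  have Lm : LB (sup (sval i.2) (sval j.2)).
    split; first exact: (sF.2).
    by move=> d hd; apply: sup_le; [exact: Li|exact: Lj].
  exists (exist _ _ Um, exist _ _ Lm); split; split => /=;
    by [exact: inf_lel|exact: inf_ler|exact: le_supl|exact: le_supr].
have yconv : order_conv le sup F leI y 0.
  exists I, leI, y; split=> //; split=> //; split; [|split=> //; split].
  - by move=> i j [h1 h2]; apply: le_add => //; exact: le_opp.
  - move=> q Fq qy; pose p := sup q 0.
    have Fp : F p by apply: (sF.2) => //; case: sF => [[]].
    have py i : le p (y i) by apply: sup_le.
    suff <- : p = 0 by exact: le_supl.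
    (* Since [p] lies below every gap, [u + p] is at most [d] for each [u] in [P], so [d - p] is
       again an upper bound. *)
    apply: (@shift_eq0 UB v b) => //; first exact: le_supr.
      by move=> d [_ h]; apply: h.
    move=> d Ud; split; first by apply: sublattice_sub => //; case: Ud.
    move=> u Pu; apply/le_subr_addr; rewrite addrC; apply/le_subr_addr.
    exact: (py (exist _ _ Ud, exist _ _ (LBP u Pu))).
  - move=> i0; exists i0 => i [h1 h2]; rewrite subr0 ge0_abs//.
    by apply: le_add => //; exact: le_opp.
have F0 : F 0 by case: sF => [[]].
(* Regularity yields [c] decreasing to 0 in [E]; each [c beta] dominates some gap, hence [z - w]. *)
have [B [leB [c [_ [_ [_ [_ [c0 cy]]]]]]]] := rF _ _ _ _ dI Fy F0 yconv.
apply/le_sub0; rewrite -opprB -[0]oppr0; apply/le_opp/c0 => // beta.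
have [i0 /(_ i0)] := cy beta; case: dI => _ refl _ _ => /(_ (refl i0)).
rewrite subr0 ge0_abs// => h; apply: le_trans h.
case: (iP i0) => [[Fd Ud] [Fs Ls]]; apply: le_add; first exact: zP.
by apply/le_opp/Ls.
Qed.

(* [u /\ y] and [z /\ e] have meet at most [u /\ e], and join at most [d]. *)
Lemma inf_pos_part_le u y z e w d :
  le 0 w -> le (inf u e) w -> le (inf u y) d -> le z d ->
  le (inf u y + sup (inf z e - w) 0) d.
Proof.
move=> w0 uew uyd zd; rewrite addrC; apply/le_subr_addr; apply: sup_le; last first.
  by apply/le_sub0.
apply/le_subl_addr; rewrite -addrA [- _ + w]addrC addrA; apply/le_subr_addr.
apply: (le_trans (add_inf_sup _ _)); rewrite [d + w]addrC; apply: le_add.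
  apply: le_trans uew; apply: le_inf.
    by apply: (le_trans (inf_ler _ _)); exact: inf_lel.
  by apply: (le_trans (inf_lel _ _)); exact: inf_ler.
by apply: sup_le => //; apply: le_trans zd; exact: inf_lel.
Qed.

(** For non-negative [a] this is order convergence to 0: the finite infima of the [w j] decrease to
    0. *)
Definition order_null_seq (a : nat -> E) : Prop :=
  exists w : nat -> E,
    (forall j, exists m, forall n, (m <= n)%N -> le (a n) (w j)) /\
    (forall t, (forall j, le t (w j)) -> le t 0).

(** Two rounds of [shift_eq0] on the eventual bounds of [inf (u n) y]: the first makes [z] disjoint
    from every [u k], the second then removes [z] itself. *)
Lemma regular_eventual_bound_le0 F (u : nat -> E) y z :
  sublattice sup F -> regular le sup F -> (forall n, F (u n)) ->
  (forall n, le 0 (u n)) ->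
  (forall k, order_null_seq (fun n => inf (u n) (u k))) ->
  F y -> le 0 y ->
  F z -> le 0 z ->
  (forall d k, F d -> (forall n, (k <= n)%N -> le (inf (u n) y) d) -> le z d) ->
  z = 0.
Proof.
move=> sF rF Fu u0 unull Fy y0 Fz z0 zd.
pose Q k d := forall n, (k <= n)%N -> le (inf (u n) y) d.
have Qy k : Q k y by move=> n _; exact: inf_ler.
(* Regularity extends the hypothesis on [z] to bounds in [E]; the shifted bounds below involve
   [w j], which need not lie in [F]. *)
have zE k d : Q k d -> le z d.
  move=> Qd; pose P v := exists2 n, (k <= n)%N & v = inf (u n) y.
  apply: (@regular_upper_bound F P (inf (u k) y) y) => //.
  - by move=> _ [n _ ->]; exact: sublattice_inf.
  - by exists k.
  - by move=> _ [n _ ->]; exact: inf_ler.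
  - by move=> c Fc cP; apply: (zd _ k) => // n kn; apply: cP; exists n.
  - by move=> _ [n kn ->]; exact: Qd.
have zu k : le (inf z (u k)) 0.
  have [w [uw winf]] := unull k; apply: winf => j; have [m uwm] := uw j.
  (* The excess of [inf z (u k)] over [w j] can be subtracted from any bound valid from [m] on, as
     [inf (u n) (u k)] is below [w j] there. *)
  pose p := sup (inf z (u k) - w j) 0.
  suff p0 : p = 0 by apply/le_sub0; rewrite -opprB -oppr0 -p0; apply/le_opp/le_supl.
  apply: (@shift_eq0 (Q m) (inf (u m) y) y) => //.
  - exact: le_supr.
  - by move=> d; apply.
  - move=> d Qd n mn; apply/le_subr_addr; apply: inf_pos_part_le.
    + by apply: le_trans (uwm _ (leqnn m)); exact: inf_ge0.
    + exact: uwm.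
    + exact: Qd n mn.
    + exact: zE Qd.
(* By disjointness the meet of [inf (u n) y] and [z] is at most 0, so their sum is at most their
   join, hence at most [d]. *)
apply: (@shift_eq0 (Q 0) (inf (u 0) y) y) => //; first by move=> d; apply.
move=> d Qd n _; apply/le_subr_addr; apply: (le_trans (add_inf_sup _ _)).
rewrite -[d]add0r; apply: le_add; last by apply: sup_le; [exact: Qd|exact: zE Qd].
apply: le_trans (zu n); apply: le_inf; first exact: inf_ler.
by apply: (le_trans (inf_lel _ _)); exact: inf_lel.
Qed.

(** * Gauges and order null sequences *)

(* The traces on [0, e] of a countable base of neighbourhoods of 0 in a
   metrisable locally solid topology for which [0, e] is complete. *)
Definition gauge (e : E) (N : nat -> E -> Prop) : Prop :=
  [/\ (forall j, N j 0),
      (forall j x y t, N j.+1 x -> N j.+1 y -> le 0 t -> le t e ->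
         le t (x + y) -> N j t),
      (forall t, (forall j, N j t) -> t = 0) &
      (forall u, (forall n, Defs.interval le 0 e (u n)) ->
         (forall j, exists n0, forall m n, (n0 <= m)%N -> (n0 <= n)%N ->
            N j (abs (u m - u n))) ->
         exists2 z, Defs.interval le 0 e z &
           forall j, exists n0, forall n, (n0 <= n)%N -> N j (abs (u n - z)))].

(** The halving condition with second summand 0: passing to smaller elements costs one index. *)
Lemma gauge_le_step e N j x t : gauge e N ->
  N j.+1 x -> le 0 t -> le t e -> le t x -> N j t.
Proof.
move=> [N0 Nhalf _ _] Nx t0 te tx.
by apply: (Nhalf j x 0); rewrite ?addr0.
Qed.

Lemma gauge_mono e N i j t : gauge e N -> (j <= i)%N -> le 0 t -> le t e ->
  N i t -> N j t.
Proof.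
move=> gN /subnK <- t0 te; elim: (i - j)%N => // n IH Nt; apply: IH.
by apply: (gauge_le_step gN) Nt _ _ _ => //; exact: le_refl.
Qed.

Fixpoint partial_sup (a : nat -> E) (k m : nat) : E :=
  if m is m'.+1 then sup (partial_sup a k m') (a (k + m')%N) else 0.

Lemma partial_sup_interval e a k m : le 0 e ->
  (forall n, Defs.interval le 0 e (a n)) -> Defs.interval le 0 e (partial_sup a k m).
Proof.
move=> e0 ae; elim: m => [|m [s0 se]] /=; first by split=> //; exact: le_refl.
split; first by apply: le_trans s0 _; exact: le_supl.
by apply: sup_le => //; case: (ae (k + m)%N).
Qed.

Lemma partial_sup_mono a k m p : le (partial_sup a k m) (partial_sup a k (m + p)).
Proof.
elim: p => [|p IH]; first by rewrite addn0; exact: le_refl.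
by rewrite addnS /=; apply: le_trans IH _; exact: le_supl.
Qed.

(* [sup_{n > k} a n] exists as the limit of its partial sups, which are Cauchy
   because the [a n] are summably small. *)
Lemma gauge_tail_bound e N a k : gauge e N ->
  (forall n, Defs.interval le 0 e (a n)) ->
  (forall n, (k < n)%N -> N n.+1 (a n)) ->
  exists z, (forall n, (k < n)%N -> le (a n) z) /\
            (forall t, le 0 t -> le t z -> N k t).
Proof.
move=> gN ae aN; have [N0 Nhalf Nsep Ncomplete] := gN.
have e0 : le 0 e by case: (ae 0) => h1 h2; exact: le_trans h1 h2.
pose s := partial_sup a k.+1.
have sI m : Defs.interval le 0 e (s m) by exact: partial_sup_interval.
have sM m p : le (s m) (s (m + p)%N) by exact: partial_sup_mono.
have dI m p : Defs.interval le 0 e (s (m + p)%N - s m).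
  split; first by apply/le_sub0.
  apply/le_subl_addr; rewrite -[s (m + p)%N]addr0.
  by apply: le_add; [case: (sI (m + p)%N)|case: (sI m)].
(* Telescoping: the first increment is at most [a (k.+1 + m)], which lies one index deeper, as does
   the rest by induction; one halving combines them. *)
have dN p m : N (k.+1 + m)%N (s (m + p)%N - s m).
  elim: p m => [|p IH] m; first by rewrite addn0 subrr.
  have [d0 de] := dI m p.+1.
  apply: (Nhalf _ (a (k.+1 + m)%N) (s (m.+1 + p)%N - s m.+1)) => //.
  - by apply: aN; rewrite addSn ltnS leq_addr.
  - by rewrite -addnS; apply: IH.
  rewrite [(m.+1 + p)%N]addSnnS addrCA; apply: le_add; first exact: le_refl.
  apply/le_subr_addr; rewrite addrC; apply/le_subl_addr; apply: sup_le.
    by rewrite -[X in le X _]add0r; apply: le_add; [case: (ae (k.+1 + m)%N)|exact: le_refl].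
  by rewrite -[X in le X _]addr0; apply: le_add; [exact: le_refl|case: (sI m)].
have [z [z0 ze] zlim] : exists2 z, Defs.interval le 0 e z &
    forall j, exists n0, forall n, (n0 <= n)%N -> N j (abs (s n - z)).
  apply: Ncomplete => // j; exists j.
  suff h m n : (j <= m)%N -> (m <= n)%N -> N j (abs (s m - s n)).
    move=> m n jm jn; case/orP: (leq_total m n) => mn; first exact: h.
    by rewrite abs_distC; exact: h.
  move=> jm /subnKC <-; rewrite abs_distC; have [d0 de] := dI m (n - m)%N.
  rewrite ge0_abs//; apply: (gauge_mono (i := (k.+1 + m)%N) gN) => //.
  by rewrite (leq_trans jm)// leq_addl.
(* The positive part of [s m - z] is below [abs (s n - z)] for all later [n], hence in every
   [N j]. *)
have sz m : le (s m) z.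
  suff t0 : sup (s m - z) 0 = 0 by apply/le_sub0; rewrite -opprB -oppr0 -t0; apply/le_opp/le_supl.
  apply: Nsep => j; have [n0 hn] := zlim j.+1.
  apply: (gauge_le_step gN) (hn (n0 + m)%N (leq_addr _ _)) _ _ _.
  - exact: le_supr.
  - apply: sup_le => //; apply/le_subl_addr; rewrite -[s m]addr0.
    by apply: le_add => //; case: (sI m).
  apply: sup_le; last exact: abs_ge0.
  apply: le_trans (le_abs _); rewrite addnC; apply: le_add => //; exact: le_refl.
exists z; split=> [n kn|t t0 tz].
  apply: le_trans (sz (n - k.+1).+1); rewrite /s /= subnKC//; exact: le_supr.
(* [z] is at most [s m + abs (s m - z)], and both summands lie in [N k.+1] for this [m]. *)
have [m hm] := zlim k.+1.
apply: (Nhalf _ (s m) (abs (s m - z))) => //.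
- have := dN m 0; rewrite add0n /= subr0 addn0; exact.
- exact: hm.
- exact: le_trans tz ze.
apply: le_trans tz _; rewrite abs_distC addrC; apply/le_subl_addr; exact: le_abs.
Qed.

Lemma gauge_order_null e N a n0 : gauge e N ->
  (forall n, Defs.interval le 0 e (a n)) ->
  (forall n, (n0 <= n)%N -> N n.+1 (a n)) -> order_null_seq a.
Proof.
move=> gN ae aN; have [N0 Nhalf Nsep Ncomplete] := gN.
have /choice [w hw] : forall j, exists z,
    (forall n, (n0 + j < n)%N -> le (a n) z) /\
    (forall t, le 0 t -> le t z -> N (n0 + j)%N t).
  move=> j; apply: gauge_tail_bound gN ae _ => n jn; apply: aN.
  by apply: leq_trans (ltnW jn); exact: leq_addr.
(* The meet with [e] keeps the positive parts of lower bounds inside [0, e], where the gauge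
   conditions apply. *)
exists (fun j => inf (w j) e); split=> [j|t tw].
  exists (n0 + j).+1%N => n jn; apply: le_inf; last by case: (ae n).
  by case: (hw j) => h _; apply: h.
suff t0 : sup t 0 = 0 by rewrite -[X in le _ X]t0; exact: le_supl.
apply: Nsep => j; case: (hw j) => _ h.
have te : le (sup t 0) e.
  apply: sup_le; first by apply: le_trans (tw 0%N) _; exact: inf_ler.
  by case: (ae 0%N) => h1 h2; exact: le_trans h1 h2.
apply: (gauge_mono (i := (n0 + j)%N) gN) => //; rewrite ?leq_addl//; first exact: le_supr.
apply: h; first exact: le_supr.
apply: sup_le; first by apply: le_trans (tw j) _; exact: inf_lel.
case: (hw j) => h _; apply: le_trans (h (n0 + j).+1%N (leqnn _)).
by case: (ae (n0 + j).+1%N).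
Qed.

(** * Gauges from metrisable locally solid topologies *)

Lemma band_gen_ideal e : ideal le sup (band_gen le sup e).
Proof.
split; [split|split=> //].
- by move=> B [[[h _ _] _] _] _.
- move=> x y hx hy B bB Be; case: (bB) => [[[_ h _] _] _].
  exact: h (hx B bB Be) (hy B bB Be).
- move=> a x hx B bB Be; case: (bB) => [[[_ _ h] _] _].
  exact: h (hx B bB Be).
- move=> x y hx _ yx B bB Be; case: (bB) => [[_ [_ h]] _].
  exact: (h x y (hx B bB Be) Logic.I yx).
Qed.

Lemma band_gen_interval e y : Defs.interval le 0 e y -> band_gen le sup e y.
Proof.
move=> [y0 ye] B [[_ [_ h]] _] Be; apply: (h e) => //.
by rewrite !ge0_abs//; exact: le_trans y0 ye.
Qed.

(** Continuity of addition at the pair [x], [- x], with the second argument then fixed. *)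
Lemma linear_open_translate (G : E -> Prop) T U x :
  linear_on G T -> G x -> G (- x) -> T U -> U 0 ->
  exists V, [/\ T V, V x & forall v, V v -> U (v - x)].
Proof.
move=> [lin _] Gx GNx TU U0.
have [|V [W [TV TW Vx Wx VW]]] := lin U x (- x) TU Gx GNx; first by rewrite subrr.
by exists V; split=> // v Vv; exact: VW.
Qed.

(** Solidity enters on both sides of the continuity of addition at 0: to replace [x] and [y] by
    their moduli, and to pass from [abs x + abs y] to [t]. *)
Lemma locally_solid_halving (G : E -> Prop) T U :
  ideal le sup G -> locally_solid_on le sup G T -> T U -> U 0 ->
  exists V, [/\ T V, V 0 &
    forall x y t, V x -> V y -> le (abs t) (abs x + abs y) -> U t].
Proof.
move=> [[G0 GD GZ] [_ Gsolid]] [[TG _ _ _ TI] _ [lin _] solid] TU U0.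
have [N [[NG Nsolid] [V0 [TV0 V00 V0N]] NU]] := solid U TU U0.
have [|V [W [TV TW V_0 W_0 VW]]] := lin V0 0 0 TV0 G0 G0; first by rewrite addr0.
have [M [[MG Msolid] [V1 [TV1 V10 V1M]] MVW]] :=
  solid _ (TI _ _ TV TW) (conj V_0 W_0).
have absG x : G x -> G (abs x).
  by move=> Gx; apply: (Gsolid x) => //; rewrite ge0_abs; [exact: le_refl|exact: abs_ge0].
have absM x : V1 x -> M (abs x).
  move=> V1x; apply: (Msolid x); first exact: V1M.
    exact/absG/(TG _ TV1).
  by rewrite ge0_abs; [exact: le_refl|exact: abs_ge0].
exists V1; split=> // x y t V1x V1y txy; apply: NU.
have abs2 : abs (abs x + abs y) = abs x + abs y.
  by apply: ge0_abs; rewrite -[0]addr0; apply: le_add; exact: abs_ge0.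
apply: (Nsolid (abs x + abs y)).
- by apply/V0N/VW; [case: (MVW _ (absM _ V1x))|case: (MVW _ (absM _ V1y))].
- apply: (Gsolid (abs x + abs y)) => //; last by rewrite abs2.
  by apply: GD; apply/absG/(TG _ TV1).
- by rewrite abs2.
Qed.

Lemma metrisable_base (G : E -> Prop) T : topology_on G T -> metrisable_on G T ->
  G 0 -> exists B : nat -> E -> Prop,
    [/\ (forall n, T (B n)), (forall n, B n 0),
        (forall t, (forall n, B n t) -> t = 0) &
        (forall U, T U -> U 0 -> exists n, forall t, B n t -> U t)].
Proof.
move=> [TG _ _ _ _] [d [d_ge0 d_eq0 dC dD Td]] G0.
exists (fun n t => G t /\ d 0 t < n.+1%:R^-1).
have archi (eps : R) : 0 < eps -> exists n : nat, n.+1%:R^-1 < eps.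
  move=> eps0; exists (Num.trunc eps^-1).
  by rewrite invf_plt ?posrE// truncnS_gt.
split.
- move=> n; apply/Td => [t []//|t [Gt dt]].
  exists (n.+1%:R^-1 - d 0 t) => [|y Gy dy]; first by rewrite subr_gt0.
  split=> //; apply: le_lt_trans (dD _ _ _ G0 Gt Gy) _.
  by rewrite addrC -ltrBrDr.
- move=> n; split=> //; have /(d_eq0 _ _ G0 G0) -> : 0 = 0 :> E by [].
  by rewrite invr_gt0.
- move=> t ht; have [Gt _] := ht 0; symmetry; apply/d_eq0 => //.
  apply/eqP; rewrite eq_le d_ge0// andbT leNgt; apply/negP => /archi [n].
  by have [_ /lt_trans h] := ht n; move=> /h; rewrite ltxx.
move=> U TU U0; have [|eps /archi[n hn] hU] := (Td U (TG U TU)).1 TU 0; first exact.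
by exists n => t [Gt dt]; apply: hU => //; exact: lt_trans dt hn.
Qed.

(** Repeated halving along a metric base of the band topology. The last clause carries smallness
    from [tau] to the gauge: [inf (abs u) e] lies in the band for every [u]. *)
Lemma exists_gauge (tau : (E -> Prop) -> Prop) e :
  locally_solid_on le sup (fun _ => True) tau -> lics_submetrisable le sup tau ->
  le 0 e ->
  exists N, gauge e N /\
    forall j, exists U, [/\ tau U, U 0 & forall u, U u -> N j (inf (abs u) e)].
Proof.
move=> [_ _ _ tausolid] lics e0; have [T [lsT mT finerT complT]] := lics e e0.
pose G := band_gen le sup e.
have idG : ideal le sup G := band_gen_ideal e.
have [[G0 GD GZ] [_ Gsolid]] := idG.
have GN x : G x -> G (- x) by move=> Gx; rewrite -scaleN1r; exact: GZ.
have [topT _ linT _] := lsT; have [TG TGT _ _ TI] := topT.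
have [B [TB B0 Bsep Bbase]] := metrisable_base topT mT G0.
(* Recursion needs a total function, so [half] is left unconstrained off the open neighbourhoods of
   0. *)
have /choice [half half_spec] : forall U, exists V, T U -> U 0 -> [/\ T V, V 0 &
    forall x y t, V x -> V y -> le (abs t) (abs x + abs y) -> U t].
  move=> U; have [[TU U0]|h] := pselect (T U /\ U 0).
    by have [V hV] := locally_solid_halving idG lsT TU U0; exists V.
  by exists U => TU U0; case: h.
(* Intersecting with [B m] at each stage makes the sequence refine the base and separate 0. *)
pose N := fix N n := if n is m.+1 then half (fun t => N m t /\ B m t) else G.
have TN n : T (N n) /\ N n 0.
  elim: n => [//|n [TNn Nn0]] /=.
  by have [] := half_spec _ (TI _ _ TNn (TB n)) (conj Nn0 (B0 n)).
have halfN n x y t : N n.+1 x -> N n.+1 y -> le (abs t) (abs x + abs y) ->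
    N n t /\ B n t.
  case: (TN n) => TNn Nn0.
  by have [_ _ h] := half_spec _ (TI _ _ TNn (TB n)) (conj Nn0 (B0 n)); exact: h.
have stepN n x t : N n.+1 x -> le (abs t) (abs x) -> N n t /\ B n t.
  by move=> Nx tx; apply: (halfN n x 0) => //; [exact: (TN n.+1).2|rewrite abs0 addr0].
exists N; split; last first.
  move=> j; have [V [tauV hV]] := finerT _ (TN j).1.
  have V0 : V 0 by case: ((hV 0).1 (TN j).2).
  have [S [[_ Ssolid] [U [tauU U0 US]] SV]] := tausolid V tauV V0.
  exists U; split=> // u Uu; apply/hV.
  have inf0 : le 0 (inf (abs u) e) by apply: inf_ge0 => //; exact: abs_ge0.
  split; last by apply: band_gen_interval; split=> //; exact: inf_ler.
  by apply/SV/(Ssolid u) => //; [exact: US|rewrite ge0_abs//; exact: inf_lel].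
split.
- by move=> j; exact: (TN j).2.
- move=> j x y t Nx Ny t0 te txy; apply: (halfN j x y t _ _ _).1 => //.
  rewrite ge0_abs//; apply: (le_trans txy).
  by apply: le_add; exact: le_abs.
- move=> t Nt; apply: Bsep => n; apply: (stepN n t t _ _).2 => //; exact: le_refl.
move=> u ue uN.
(* The gauge controls moduli; one step down puts the differences themselves into the base sets, so
   [u] is Cauchy. *)
have [|z ze uz] := complT u ue.
  move=> V TV V0; have [n BV] := Bbase V TV V0; have [n0 hn0] := uN n.+1.
  exists n0 => p q n0p n0q; apply/BV/(stepN n _ _ (hn0 p q n0p n0q) _).2.
  by rewrite [X in le _ X]ge0_abs; [exact: le_refl|exact: abs_ge0].
exists z => // j.
have Gz : G z := band_gen_interval ze.
have [V [TV Vz hV]] := linear_open_translate linT Gz (GN _ Gz) (TN j.+1).1 (TN j.+1).2.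
have [n0 hn0] := uz V TV Vz; exists n0 => n n0n.
apply: (stepN j _ _ (hV _ (hn0 n n0n)) _).1.
by rewrite ge0_abs; [exact: le_refl|exact: abs_ge0].
Qed.

(** * Unbounded order convergence *)

(** The dominating net consists of all eventual upper bounds in [F], directed downwards by finite
    infima; its infimum in [F] is 0 because the gauges make each [inf (u n) (u k)] order null in
    [n]. *)
Lemma uo_conv_gauge F (s : nat -> E) x (N : nat -> nat -> E -> Prop) :
  sublattice sup F -> regular le sup F -> (forall n, F (s n)) -> F x ->
  (forall k, gauge (abs (s k - x)) (N k)) ->
  (forall k n, (k < n)%N -> N k n.+1 (inf (abs (s n - x)) (abs (s k - x)))) ->
  uo_conv le sup F (fun m n : nat => (m <= n)%N) s x.
Proof.
move=> sF rF Fs Fx gN Ns y Fy.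
pose u n := abs (s n - x); pose v n := inf (u n) (abs y).
have Fu n : F (u n) by apply: sublattice_abs => //; exact: sublattice_sub.
have Fv n : F (v n) by apply: sublattice_inf => //; exact: sublattice_abs.
have v0 n : le 0 (v n) by apply: inf_ge0; exact: abs_ge0.
have unull k : order_null_seq (fun n => inf (u n) (u k)).
  apply: (gauge_order_null (gN k) (n0 := k.+1)) => [n|n kn]; last exact: Ns.
  by split; [apply: inf_ge0; exact: abs_ge0|exact: inf_ler].
pose D d := F d /\ exists k, forall n, (k <= n)%N -> le (v n) d.
exists {d | D d}, (fun c d => le (sval d) (sval c)), sval.
split; first split.
- have Dy : D (abs y).
    by split; [exact: sublattice_abs|exists 0 => n _; exact: inf_ler].
  by exists (exist _ _ Dy).
- by move=> d; exact: le_refl.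
- by move=> a b c ab bc; exact: le_trans bc ab.
- move=> [a [Fa [i ha]]] [b [Fb [j hb]]].
  have Dm : D (inf a b).
    split; first exact: sublattice_inf.
    exists (i + j)%N => n ijn; apply: le_inf.
      by apply/ha/(leq_trans _ ijn)/leq_addr.
    by apply/hb/(leq_trans _ ijn)/leq_addl.
  by exists (exist _ _ Dm); split; [exact: inf_lel|exact: inf_ler].
split; first by case=> d [].
split; first by [].
split.
  by case=> d [Fd [k hd]] /=; apply: le_trans (v0 k) (hd k (leqnn k)).
split; last first.
  move=> [d [Fd [k hd]]]; exists k => n kn /=.
  by rewrite subr0 ge0_abs; [exact: hd|exact: v0].
move=> z Fz zD.
have F0 : F 0 by case: sF => [[]].
suff <- : sup z 0 = 0 by exact: le_supl.
apply: (regular_eventual_bound_le0 sF rF Fu _ unull (sublattice_abs sF Fy)) => //.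
- by move=> n; exact: abs_ge0.
- exact: abs_ge0.
- exact: (sF.2).
- exact: le_supr.
move=> d k Fd dk; have Dd : D d by split=> //; exists k.
apply: sup_le; first exact: (zD (exist _ _ Dd)).
exact: le_trans (v0 k) (dk k (leqnn k)).
Qed.

Lemma uo_conv_cst F x : F 0 ->
  uo_conv le sup F (fun m n : nat => (m <= n)%N) (fun=> x) x.
Proof.
move=> F0 y Fy; exists unit, (fun _ _ => True), (fun=> 0).
split; first by split=> *; try exists tt.
do 3 (split; first by move=> *; exact: le_refl || exact: F0).
split; first by move=> z _ /(_ tt).
move=> _; exists 0 => n _; rewrite subrr abs0 subr0.
have -> : inf 0 (abs y) = 0.
  by apply: le_anti; [exact: inf_lel|apply: inf_ge0; [exact: le_refl|exact: abs_ge0]].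
by rewrite abs0; exact: le_refl.
Qed.

Lemma net_conv_sub (tau : (E -> Prop) -> Prop) (A : Type) (leA : A -> A -> Prop)
    (xa : A -> E) x U :
  locally_solid_on le sup (fun _ => True) tau -> net_conv tau leA xa x ->
  tau U -> U 0 -> exists a0, forall a, leA a0 a -> U (xa a - x).
Proof.
move=> [_ _ lin _] xax tauU U0.
have [V [tauV Vx VU]] := linear_open_translate (x := x) lin Logic.I Logic.I tauU U0.
by have [a0 h] := xax V tauV Vx; exists a0 => a /h; exact: VU.
Qed.

Lemma net_conv_largest (tau : (E -> Prop) -> Prop) (A : Type) (leA : A -> A -> Prop)
    (xa : A -> E) x al :
  locally_solid_on le sup (fun _ => True) tau -> net_conv tau leA xa x ->
  (forall a, leA a al) -> x = xa al.
Proof.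
move=> [_ hausd _ _] xax top; apply: contrapT => /(hausd _ _ Logic.I Logic.I).
move=> [U [V [tauU tauV Ux Va UV]]]; have [a0 h] := xax U tauU Ux.
exact: UV (h al (top a0)) Va.
Qed.

End VectorLattice.

(** * The choice game *)

Section AdaptiveChoice.
Variables (A : Type) (leA : A -> A -> Prop).
Hypothesis dirA : directed leA.

Definition eventually (P : A -> Prop) : Prop :=
  exists a0, forall a, leA a0 a -> P a.

Lemma eventually_and P Q :
  eventually P -> eventually Q -> eventually (fun a => P a /\ Q a).
Proof.
case: dirA => _ _ tr dir [a hP] [b hQ]; have [c [ac bc]] := dir a b.
by exists c => d cd; split; [apply/hP/(tr _ _ _ ac)|apply/hQ/(tr _ _ _ bc)].
Qed.

Lemma eventually_seq (I : Type) (P : I -> A -> Prop) (s : seq I) :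
  (forall i, eventually (P i)) ->
  eventually (fun a => forall i, List.In i s -> P i a).
Proof.
move=> hP; elim: s => [|i s IH].
  by case: dirA => [[a _] _ _ _]; exists a.
have [a0 h] := eventually_and (hP i) IH; exists a0 => a /h [Pi Ps] j /= [<-//|].
exact: Ps.
Qed.

Hypothesis no_top : ~ exists al, forall a, leA a al.

(** Past a common upper bound of [a] and some [b] not below [a], no index is below [a]. *)
Lemma eventually_strict a : eventually (strict leA a).
Proof.
case: dirA => _ _ tr dir.
have [b nba] : exists b, ~ leA b a.
  by apply: contrapT => h; apply: no_top; exists a => b; apply: contrapT => ?; apply: h; exists b.
have [c [ac bc]] := dir a b; exists c => d cd; split; first exact: tr ac cd.
by move=> da; apply: nba; exact: (tr _ _ _ bc (tr _ _ _ cd da)).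
Qed.

(** The strategy receives the opponent's moves alone; its own earlier answers are recovered by
    replaying the game. *)
Lemma adaptive_choice (P : nat -> A -> A -> Prop) :
  (forall n b, eventually (P n b)) ->
  exists strat : seq A -> A, forall t : nat -> A,
    let al := fun n => strat (mkseq t n.+1) in
    [/\ (forall n, strict leA (al n) (al n.+1)),
        (forall n, strict leA (t n) (al n)) &
        (forall k n, (k < n)%N -> P n (al k) (al n))].
Proof.
move=> evP; have [[x0 _] refl _ _] := dirA.
(* [ha] pairs the earlier answers with the current move; the number of answers is the round. *)
have /choice [pick pickP] : forall ha : seq A * A, exists c,
    strict leA ha.2 c /\
    forall b, List.In b ha.1 -> strict leA b c /\ P (size ha.1) b c.
  move=> [h a].
  have [c hc] := eventually_and (eventually_strict a)
    (eventually_seq h (fun b => eventually_and (eventually_strict b) (evP (size h) b))).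
  by exists c; apply: hc.
pose hist := fix hist (r : seq A) :=
  if r is a :: r' then pick (hist r', a) :: hist r' else [::].
(* Reversal lets the recursion peel off the newest move; [x0] is the value for an empty game. *)
exists (fun s => head x0 (hist (rev s))) => t al.
pose H n := hist (rev (mkseq t n)).
have HS n : H n.+1 = pick (H n, t n) :: H n.
  by rewrite /H /mkseq -addn1 iotaD map_cat rev_cat.
have alE n : al n = pick (H n, t n) by rewrite /al -/(H n.+1) HS.
have sH n : size (H n) = n by elim: n => // n IH; rewrite HS /= IH.
have inH k n : (k < n)%N -> List.In (al k) (H n).
  elim: n => // n IH; rewrite ltnS leq_eqVlt HS alE => /orP[/eqP ->|kn]; first by left.
  by right; rewrite -alE; exact: IH.
have later k n : (k < n)%N -> strict leA (al k) (al n) /\ P n (al k) (al n).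
  by move=> kn; have [_ /(_ _ (inH _ _ kn))] := pickP (H n, t n); rewrite -alE /= sH.
split=> [n|n|k n kn].
- by case: (later n n.+1).
- by rewrite alE; case: (pickP (H n, t n)).
- by case: (later k n kn).
Qed.

End AdaptiveChoice.

(** * Playing the choice game with the gauges of the net *)

Theorem theorem4p1 (R : realType) (E : lmodType R)
    (le : E -> E -> Prop) (sup : E -> E -> E)
    (tau : (E -> Prop) -> Prop) (F : E -> Prop)
    (A : Type) (leA : A -> A -> Prop) (xa : A -> E) (x : E) :
  is_vector_lattice le sup ->
  locally_solid_on le sup (fun _ => True) tau ->
  lics_submetrisable le sup tau ->
  sublattice sup F -> regular le sup F ->
  directed leA -> (forall a, F (xa a)) -> F x ->
  net_conv tau leA xa x ->
  [/\ (* A has a largest element *)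
      (forall al, (forall a, leA a al) -> x = xa al),
      (* A has no largest element: the adaptive choice game *)
      (~ (exists al, forall a, leA a al) ->
         exists strat : seq A -> A,
           forall t : nat -> A,
             let al := fun n => strat (mkseq t n.+1) in
             [/\ (forall n, strict leA (al n) (al n.+1)),
                 (forall n, strict leA (t n) (al n)) &
                 uo_conv le sup F (fun m n : nat => (m <= n)%N) (fun n => xa (al n)) x]),
      (* in particular, for arbitrary A *)
      (exists al : nat -> A, (forall n, leA (al n) (al n.+1)) /\
         uo_conv le sup F (fun m n : nat => (m <= n)%N) (fun n => xa (al n)) x) &
      (~ (exists al, forall a, leA a al) ->
         exists al : nat -> A, (forall n, strict leA (al n) (al n.+1)) /\
           uo_conv le sup F (fun m n : nat => (m <= n)%N) (fun n => xa (al n)) x)].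
Proof.
move=> VL lsT lics sF rF dirA Fxa Fx xax.
have F0 : F 0 by case: sF => [[]].
have game : ~ (exists al, forall a, leA a al) ->
    exists strat : seq A -> A, forall t : nat -> A,
      let al := fun n => strat (mkseq t n.+1) in
      [/\ (forall n, strict leA (al n) (al n.+1)),
          (forall n, strict leA (t n) (al n)) &
          uo_conv le sup F (fun m n : nat => (m <= n)%N) (fun n => xa (al n)) x].
  move=> no_top; pose e b := vabs sup (xa b - x).
  (* One gauge per index [b], fixed before play, so that each round can test against the gauges of
     all earlier answers. *)
  have /choice [N hN] : forall b, exists N, gauge le sup (e b) N /\
      forall j, exists U, [/\ tau U, U 0 & forall u, U u -> N j (vinf sup (vabs sup u) (e b))].
    by move=> b; apply: (exists_gauge VL lsT lics); exact: abs_ge0 VL _.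
  (* The depth [n.+1] grows with the round, which gives the summable smallness against each earlier
     answer [b]. *)
  pose P n b a := N b n.+1 (vinf sup (e a) (e b)).
  have evP n b : eventually leA (P n b).
    have [U [tauU U0 UN]] := (hN b).2 n.+1.
    have [a0 h] := net_conv_sub lsT xax tauU U0.
    by exists a0 => a /h; exact: UN.
  have [strat hs] := adaptive_choice dirA no_top evP.
  exists strat => t; have [h1 h2 h3] := hs t; split=> //.
  apply: (uo_conv_gauge VL (N := fun k => N (strat (mkseq t k.+1)))) => //.
  by move=> k; case: (hN (strat (mkseq t k.+1))).
have [[a0 _] refl _ _] := dirA.
have incr : ~ (exists al, forall a, leA a al) ->
    exists al : nat -> A, (forall n, strict leA (al n) (al n.+1)) /\
      uo_conv le sup F (fun m n : nat => (m <= n)%N) (fun n => xa (al n)) x.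
  (* The game is played against constant moves. *)
  move=> /game [strat /(_ (fun=> a0)) [h1 _ h3]].
  by exists (fun n => strat (mkseq (fun=> a0) n.+1)).
split=> //.
  by move=> al; exact: net_conv_largest lsT xax.
have [[al top]|/incr [al [al_incr al_uo]]] := pselect (exists al, forall a, leA a al).
  exists (fun=> al); split=> //.
  by rewrite -(net_conv_largest lsT xax top); exact: (uo_conv_cst VL _ F0).
by exists al; split=> // n; case: (al_incr n).
Qed.
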